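(* Fix a constant $d\in\mathbb{N}$, and let $k=k(n)$ satisfy $k\ge c(G^d_n)$ and $k=O(n^d)$. Then $\mathrm{capt}_k(G^d_n)=\Theta\left(n/k^{1/d}\right)$ as $n\to\infty$.
   Context: $G^d_q=\square_{i=1}^d P_q$ is the $d$-dimensional Cartesian grid (Cartesian product of $d$ paths on $q$ vertices), viewed as a reflexive graph. The game of Cops and Robbers: cops choose starting vertices (round 0), then the robber; players alternate, cops (any subset) moving to adjacent vertices or staying put, then the robber moving or staying; cops win by occupying the robber's vertex. $c(G)$ is the least number of cops with a winning strategy. For $k\ge c(G)$, $\mathrm{capt}_k(G)$ is the minimum over $k$-cop strategies of the number of rounds (excluding round 0) until capture against an optimally evading robber. Asymptotics are as $n\to\infty$.
   Formalization: A game is taken to last at least one round, so the capture time is 1 instead of 0 when k is at least n^d; with value 0 the claim fails for k = n^d, and nothing changes when k < n^d. *)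

(* Defs.v *)
From mathcomp Require Import all_boot all_order all_algebra.
From mathcomp Require Import all_classical all_reals all_analysis.

Set Implicit Arguments.
Unset Strict Implicit.
Unset Printing Implicit Defensive.

Local Open Scope classical_set_scope.
Local Open Scope nat_scope.

(* Least element of a set of naturals; junk value 0 when the set is empty. *)
Definition least (A : set nat) : nat :=
  xget 0 [set m | A m /\ forall j, A j -> m <= j].

Lemma leastP (A : set nat) :
  (exists m, A m) -> A (least A) /\ forall j, A j -> least A <= j.
Proof.
move=> [m Am]; rewrite /least; apply: (@xgetPex _ 0 [set m | A m /\ _]).
have ex : exists n, `[< A n >] by exists m; apply/asboolP.
case: (ex_minnP ex) => p /asboolP Ap minp; exists p; split=> // j Aj.
by apply: minp; apply/asboolP.
Qed.

Definition path_adj (q : nat) : rel 'I_q :=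
  fun i j => (i.+1 == j) || (j.+1 == i).
Arguments path_adj : clear implicits.

Definition cart_power (d : nat) (T : finType) (e : rel T) :
    rel {ffun 'I_d -> T} :=
  fun u v => [exists i, e (u i) (v i) && [forall j, (j != i) ==> (u j == v j)]].
Arguments cart_power d {T} e.

(* The loop at every vertex is what allows a player to stay put. *)
Definition grid (d q : nat) : rel {ffun 'I_d -> 'I_q} :=
  fun u v => (u == v) || cart_power d (path_adj q) u v.
Arguments grid : clear implicits.

Section Game.
Variables (T : finType) (e : rel T).

(* A deterministic strategy of [k] cops with perfect information: from the
   list [r_0; ...; r_(t-1)] of the robber's positions so far it gives the
   positions of the cops in round [t]; on the empty list it gives their
   starting positions.  The cops' own past positions are determined by the
   robber's, so they need not appear in the history. *)
Definition cop_strategy (k : nat) := seq T -> 'I_k -> T.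

Definition cop_legal k (s : cop_strategy k) : Prop :=
  forall (h : seq T) (x : T) (i : 'I_k), e (s h i) (s (rcons h x) i).

(* [r t] is the robber's position at the end of round [t].  A sequence is as
   strong as a strategy here, because the cops' strategy is deterministic. *)
Definition robber_legal (r : nat -> T) : Prop :=
  forall t, e (r t) (r t.+1).

Definition cops_at k (s : cop_strategy k) (r : nat -> T) (t : nat) : 'I_k -> T :=
  s (mkseq r t).

(* In round [t] the cops, who move first, find the robber at [r t.-1], and the
   robber then moves to [r t].  For [t = 0] this is capture at the placement
   of the robber. *)
Definition captured_in k (s : cop_strategy k) (r : nat -> T) (t : nat) : Prop :=
  exists i, cops_at s r t i = r t.-1 \/ cops_at s r t i = r t.

Definition winning k (s : cop_strategy k) : Prop :=
  cop_legal s /\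
  forall r, robber_legal r -> exists t, captured_in s r t.

Definition winning_within k (s : cop_strategy k) (t : nat) : Prop :=
  cop_legal s /\
  forall r, robber_legal r -> exists2 u, u <= t & captured_in s r u.

Definition cop_number : nat :=
  least [set k | exists s : cop_strategy k, winning s].

(* The minimum over strategies of the worst-case number of rounds, round 0 not
   being counted.  A game lasts at least one round: a robber placed on a cop
   counts as captured in round 1.  This matters only for [k >= #|T|], where the
   capture time is 1 and not 0. *)
Definition capt (k : nat) : nat :=
  least [set t | 0 < t /\ exists s : cop_strategy k, winning_within s t].

End Game.

(* Main.v *)
(* Upper bound. On a grid of side m, d./2 + 1 cops suffice to catch the robber
   in O(m) rounds: the coordinates are covered by d./2 pairs, each given to one
   cop, and a last coordinate given to a solo cop. Outside its own coordinates
   a cop first closes its gaps and then mirrors the robber. Each cop of a pair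
   keeps an even distance, so that it wins the game projected on its two
   coordinates after O(m) moves of the robber there; the solo cop wins after
   O(m) passes. If k is larger, the grid is cut into about k boxes of side
   about n / k^(1/d), each with its own team of d./2 + 1 cops chasing the
   projection of the robber on the box; the robber coincides with one of these
   projections.

   Lower bounds. In t rounds k cops reach at most k (2t+1)^d vertices, and the
   robber can sit on any other one. Finally k <= d./2 cops never win, because
   they cannot block a robber with d neighbours, so that k >= d./2 + 1. *)
Require Import Defs.
From mathcomp Require Import all_boot all_order all_algebra.
From mathcomp Require Import all_classical all_reals all_analysis.
From mathcomp Require Import zify.
Import Order.TTheory GRing.Theory Num.Theory.
Import numFieldNormedType.Exports.

Set Implicit Arguments.
Unset Strict Implicit.
Unset Printing Implicit Defensive.
Local Open Scope nat_scope.

(** * Adjacency, and potentials in one or two coordinates *)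

Lemma gridP (d q : nat) (u v : {ffun 'I_d -> 'I_q}) :
  reflect (u = v \/ exists2 i, (u i).+1 = v i \/ (v i).+1 = u i &
             forall j, j != i -> u j = v j)
          (grid d q u v).
Proof.
apply: (iffP orP) => [[/eqP|/existsP[i /andP[]]]|[/eqP|[i uvi uv]]];
  [by left| |by left|].
- move=> /orP uvi /forallP uv; right; exists i.
    by case: uvi => /eqP; [left|right].
  by move=> j ji; have /implyP/(_ ji)/eqP := uv j.
- right; apply/existsP; exists i; apply/andP; split.
    by apply/orP; case: uvi => /eqP; [left|right].
  by apply/forallP => j; apply/implyP => ji; rewrite uv.
Qed.

Lemma grid_refl (d q : nat) (u : {ffun 'I_d -> 'I_q}) : grid d q u u.
Proof. by apply/gridP; left. Qed.

Definition gap (a b : nat) : nat := (a - b) + (b - a).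

Definition toward (a b : nat) : nat :=
  if a < b then a.+1 else if b < a then a.-1 else a.

(* The room a robber at [r] has to flee from a cop at [c], measured from the
   cop: it shrinks whenever the cop steps towards the robber. *)
Definition wall (q c r : nat) : nat := if c < r then q - c else c.

(** [S] is the distance outside the coordinate of [c] and [r]. Until it is closed, [q] stands in for
    the wall, which never exceeds [q]. *)
Definition solo_value (q S c r : nat) : nat :=
  S + (if 0 < S then q else wall q c r).

Definition stride (r r' : nat) : Prop := r.+1 = r' \/ r'.+1 = r.

(** An outer step of the robber can at most undo the outer step of the cop. Otherwise the cop gains
    a step, either outside or, once [S1 = 0], towards the robber, which cannot cross the cop without
    being caught. *)
Lemma solo_value_round (q S S1 S2 c c2 r r' : nat) :
  c < q -> r < q -> r' < q ->
  [\/ S1 = S /\ r' = r, S1 = S /\ stride r r' | r' = r /\ stride S S1] ->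
  (0 < S1 -> S2.+1 = S1 /\ c2 = c) ->
  (S1 = 0 -> S2 = 0 /\ c2 = toward c r') ->
  S2 = 0 /\ gap c2 r' = 0 \/
  solo_value q S2 c2 r' <= solo_value q S c r /\
  (S1 = S -> solo_value q S2 c2 r' < solo_value q S c r).
Proof.
rewrite /solo_value => cq rq r'q move_r; have [S1_0 _ /(_ S1_0)|S1_gt0] := posnP S1.
  move=> [-> ->]; rewrite {}S1_0 in move_r; rewrite /=.
  have [S0|S0] := posnP S; last by right; move: move_r;
    rewrite /gap /wall /toward /stride => -[]; do ![case: ifP => ?]; try lia.
  subst S.
  move: move_r; rewrite /gap /wall /toward /stride => -[]; do ![case: ifP => ?]; try lia.
move=> /(_ isT)[S2E ->] _; right.
by move: move_r;
  rewrite /wall /stride => -[]; do ![case: ifP => ?]; try lia.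
Qed.

Lemma wall_le (q c r : nat) : c < q -> wall q c r <= q.
Proof. by rewrite /wall; case: ifP; lia. Qed.

Lemma gap_toward (c r : nat) : gap (toward c r) r = (gap c r).-1.
Proof. by rewrite /gap /toward; do ![case: ifP => ?]; lia. Qed.

Lemma wall_toward (q c r : nat) : c < q -> 1 < gap c r ->
  (wall q (toward c r) r).+1 = wall q c r.
Proof.
rewrite /gap /toward => cq; case: ifP => [|le]; last case: ifP => [|ge];
  by rewrite /wall => *; do ?[case: ifP => ?]; lia.
Qed.

Lemma gap_stride (c r r' : nat) : stride r r' -> stride (gap c r) (gap c r').
Proof. by rewrite /gap /stride => -[]; lia. Qed.

Lemma wall_stride (q c r r' : nat) : stride r r' ->
  0 < gap c r -> 0 < gap c r' -> wall q c r' = wall q c r.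
Proof. by rewrite /gap /stride /wall => ? ? ?; do 2?case: ifP; lia. Qed.

(* The larger of the two gaps [x], [y] of a cop and its sign do not change
   until the gaps are equal, and from then on they are equal at each turn of
   the robber, with constant signs; the summand [q] pays for the second wall
   that enters at this transition. *)
Definition inner_value (q x y wx wy : nat) : nat :=
  if x == y then wx + wy else if y < x then x + wx + q else y + wy + q.

Lemma inner_valueC (q x y wx wy : nat) :
  inner_value q x y wx wy = inner_value q y x wy wx.
Proof. by rewrite /inner_value; do ![case: ifP => ?]; lia. Qed.

Lemma inner_value_le (q x y wx wy : nat) :
  x <= q -> y <= q -> wx <= q -> wy <= q -> inner_value q x y wx wy <= 3 * q.
Proof. by rewrite /inner_value => *; do ![case: ifP => ?]; lia. Qed.

(** Since [x + y] is even, unequal gaps differ by at least 2 and one step of the robber cannot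
    reverse their order; equal gaps are equal again after the reply. Short of capture, the cop's
    step shrinks the wall on its side. *)
Lemma inner_value_round (q x y x' y' wx wy wx' wy' wx2 : nat) :
  wy' <= q -> ~~ odd (x + y) ->
  [/\ y' = y, wy' = wy & stride x x'] \/ [/\ x' = x, wx' = wx & stride y y'] ->
  (0 < x -> 0 < x' -> wx' = wx) -> (0 < y -> 0 < y' -> wy' = wy) ->
  y' < x' -> (1 < x' -> wx2.+1 = wx') ->
  (x'.-1 = 0 /\ y' = 0) \/
  inner_value q x'.-1 y' wx2 wy' < inner_value q x y wx wy.
Proof.
rewrite /inner_value /stride => wy'q /even_halfK; set h := _./2; clearbody h.
rewrite -muln2 => xy moved sx sy lt tx.
case: moved => -[? ? step]; subst; do ![case: ifP => ?; try by exfalso; lia]; lia.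
Qed.

(** The summand [3 * q] bounds [inner_value], so that entering the inner phase never raises the
    value. *)
Definition pair_value (q S ca cb ra rb : nat) : nat :=
  S + (if 0 < S then 3 * q
       else inner_value q (gap ca ra) (gap cb rb) (wall q ca ra) (wall q cb rb)).

Lemma pair_value_round (q S S1 S2 ca cb ca2 cb2 ra rb ra' rb' : nat) :
  ca < q -> cb < q -> ra < q -> rb < q -> ra' < q -> rb' < q ->
  ~~ odd (S + gap ca ra + gap cb rb) ->
  [\/ [/\ S1 = S, rb' = rb & stride ra ra'],
      [/\ S1 = S, ra' = ra & stride rb rb'] |
      [/\ ra' = ra, rb' = rb & stride S S1]] ->
  (0 < S1 -> [/\ S2.+1 = S1, ca2 = ca & cb2 = cb]) ->
  (S1 = 0 -> S2 = 0 /\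
     if gap cb rb' < gap ca ra' then ca2 = toward ca ra' /\ cb2 = cb
     else ca2 = ca /\ cb2 = toward cb rb') ->
  (S2 = 0 /\ gap ca2 ra' = 0 /\ gap cb2 rb' = 0) \/
  pair_value q S2 ca2 cb2 ra' rb' <= pair_value q S ca cb ra rb /\
  (S1 = S -> pair_value q S2 ca2 cb2 ra' rb' < pair_value q S ca cb ra rb).
Proof.
move=> caq cbq raq rbq ra'q rb'q even moved outer_reply inner_reply.
have gap_le c r : c < q -> r < q -> gap c r <= q by rewrite /gap; lia.
have value_le c r c' r' : c < q -> r < q -> c' < q -> r' < q ->
    inner_value q (gap c r) (gap c' r') (wall q c r) (wall q c' r') <= 3 * q.
  by move=> *; apply: inner_value_le; rewrite ?gap_le ?wall_le.
rewrite /pair_value; have [S1_0|S1_gt0] := posnP S1; last first.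
  have [S2E -> ->] := outer_reply S1_gt0; right.
  case: moved => -[E1 E2 E3]; rewrite ?E1 ?E2.
  - have S_gt0 : 0 < S by lia.
    by rewrite S_gt0; have := value_le _ _ _ _ caq ra'q cbq rbq; case: ifP; lia.
  - have S_gt0 : 0 < S by lia.
    by rewrite S_gt0; have := value_le _ _ _ _ caq raq cbq rb'q; case: ifP; lia.
  have := value_le _ _ _ _ caq raq cbq rbq.
  by move: E3; rewrite /stride; case: ifP; case: ifP; lia.
have [S2_0 reply] := inner_reply S1_0; rewrite {}S2_0.
have toward_lt c r : c < q -> r < q -> toward c r < q.
  by rewrite /toward; do 2?case: ifP; lia.
have [S_0|S_gt0] := posnP S; last first.
  have [ca2q cb2q] : ca2 < q /\ cb2 < q.
    by case: ifP reply => _ [-> ->]; rewrite ?toward_lt.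
  have := value_le _ _ _ _ ca2q ra'q cb2q rb'q.
  by right=> /=; move: moved; rewrite /stride => -[] [] E1 E2 E3; lia.
have {}moved : rb' = rb /\ stride ra ra' \/ ra' = ra /\ stride rb rb'.
  by case: moved => -[E1 E2 E3]; [left|right|move: E3; rewrite /stride; lia].
(* The sum of the gaps was even and one gap has changed by one, so the reply never faces a tie. *)
have parity' : gap ca ra' != gap cb rb'.
  move: even; rewrite S_0; case: moved => -[-> /gap_stride sg].
    by have := sg ca; rewrite /stride; lia.
  by have := sg cb; rewrite /stride; lia.
suff: gap ca2 ra' = 0 /\ gap cb2 rb' = 0 \/
    inner_value q (gap ca2 ra') (gap cb2 rb') (wall q ca2 ra') (wall q cb2 rb') <
    inner_value q (gap ca ra) (gap cb rb) (wall q ca ra) (wall q cb rb).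
  by rewrite S_0 /=; lia.
rewrite S_0 add0n in even.
case: ifP reply => lt [-> ->]; rewrite gap_toward.
  apply: (@inner_value_round _ _ _ _ _ _ _ (wall q ca ra')) => //.
  - exact: wall_le.
  - by case: moved => -[-> /gap_stride]; [left|right].
  - by case: moved => -[E s]; rewrite ?E // => *; exact: wall_stride.
  - by case: moved => -[E s]; rewrite ?E // => *; exact: wall_stride.
  exact: wall_toward.
(* The same argument with the two coordinates exchanged. *)
rewrite [X in X < _]inner_valueC [X in _ < X]inner_valueC [X in X \/ _]and_comm.
apply: (@inner_value_round _ _ _ _ _ _ _ (wall q cb rb')).
- exact: wall_le.
- by rewrite addnC.
- by case: moved => -[-> /gap_stride]; [right|left].
- by case: moved => -[E s]; rewrite ?E // => *; exact: wall_stride.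
- by case: moved => -[E s]; rewrite ?E // => *; exact: wall_stride.
- by rewrite ltn_neqAle parity' leqNgt lt.
exact: wall_toward.
Qed.

(** * Replies of a single cop *)

Section Approach.
Variables d q : nat.
Implicit Types (a b i j l : 'I_d) (c r : {ffun 'I_d -> 'I_q}).

Definition approach i c r : {ffun 'I_d -> 'I_q} :=
  [ffun j => if j == i then insubd (c j) (toward (c j) (r j)) else c j].

Lemma approachE i c r : approach i c r i = toward (c i) (r i) :> nat.
Proof.
rewrite ffunE eqxx val_insubd ifT // /toward.
by have := ltn_ord (c i); have := ltn_ord (r i); do 2?case: ifP; lia.
Qed.

Lemma approach_neq i j c r : j != i -> approach i c r j = c j.
Proof. by rewrite ffunE => /negbTE->. Qed.

Lemma approach_legal i c r : grid d q c (approach i c r).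
Proof.
have E := approachE i c r; have N j := @approach_neq i j c r.
have [eqc|neqc] := eqVneq (approach i c r) c; first by rewrite eqc grid_refl.
apply/gridP; right; exists i => [|j ji]; last by rewrite N.
move: E; rewrite /toward; case: ifP => [_ ->|_]; first by left.
case: ifP => [lt ->|_ /val_inj E]; first by right; lia.
case/eqP: neqc; apply/ffunP => j; have [->//|ji] := eqVneq j i.
by rewrite N.
Qed.

(** For the solo cop, [a] and [b] are the same coordinate. *)
Definition outer a b c r : nat :=
  \sum_(j | (j != a) && (j != b)) gap (c j) (r j).

(** The additive form avoids truncated subtraction. *)
Lemma sum_update (P : pred 'I_d) (F G : 'I_d -> nat) i :
  (forall j, j != i -> F j = G j) ->
  \sum_(j | P j) F j + (if P i then G i else 0) =
  \sum_(j | P j) G j + (if P i then F i else 0).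
Proof.
move=> FG; case: ifP => Pi; last first.
  rewrite !addn0; apply: eq_bigr => j Pj; apply: FG.
  by apply: contraTneq Pj => ->; rewrite Pi.
rewrite !(bigD1 i Pi) /=.
have -> : \sum_(j | P j && (j != i)) F j = \sum_(j | P j && (j != i)) G j.
  by apply: eq_bigr => j /andP[_ /FG].
by rewrite addnC addnA [RHS]addnAC.
Qed.

Lemma outer_approach i a b c r : i != a -> i != b -> 0 < gap (c i) (r i) ->
  (outer a b (approach i c r) r).+1 = outer a b c r.
Proof.
move=> ia ib gi.
have := @sum_update (fun j => (j != a) && (j != b))
  (fun j => gap (approach i c r j) (r j)) (fun j => gap (c j) (r j)) i.
rewrite ia ib /= approachE => /(_ _)/=.
rewrite -/(outer a b _ r) -/(outer a b _ r) => H.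
have {}H : outer a b (approach i c r) r + gap (c i) (r i) =
           outer a b c r + gap (toward (c i) (r i)) (r i).
  by apply: H => j ji; rewrite approach_neq.
by move: H gi; rewrite /gap /toward; do 2?case: ifP; lia.
Qed.

Lemma outer_eq a b c c' r r' :
  (forall j, j != a -> j != b -> gap (c j) (r j) = gap (c' j) (r' j)) ->
  outer a b c r = outer a b c' r'.
Proof. by move=> E; apply: eq_bigr => j /andP[]; exact: E. Qed.

Lemma outer_le a b c r : outer a b c r <= d * q.
Proof.
apply: (@leq_trans (\sum_(j < d) q)); last by rewrite sum_nat_const card_ord.
rewrite /outer big_mkcond /=.
apply: leq_sum => j _; case: ifP => // _.
by have := ltn_ord (c j); have := ltn_ord (r j); rewrite /gap; lia.
Qed.

Lemma gap_eq0 a b c r : outer a b c r = 0 -> gap (c a) (r a) = 0 ->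
  gap (c b) (r b) = 0 -> c = r.
Proof.
move=> /eqP; rewrite sum_nat_eq0 => /forallP S0 ga gb.
have gap0 x y : gap x y = 0 -> x = y by rewrite /gap; lia.
apply/ffunP => j; apply/val_inj/gap0.
have [->//|ja] := eqVneq j a; have [->//|jb] := eqVneq j b.
by have := S0 j; rewrite ja jb => /eqP.
Qed.

Lemma gaps_refl a b r :
  (outer a b r r = 0) * (gap (r a) (r a) = 0) * (gap (r b) (r b) = 0).
Proof.
have g0 x : gap x x = 0 by rewrite /gap subnn.
by rewrite !g0; split=> //; split=> //; rewrite /outer big1.
Qed.

Lemma robber_move a b c r r' : grid d q r r' ->
  [\/ r' = r,
      [/\ outer a b c r' = outer a b c r, a != b -> r b = r' b &
          (r a).+1 = r' a \/ (r' a).+1 = r a],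
      [/\ outer a b c r' = outer a b c r, r a = r' a &
          (r b).+1 = r' b \/ (r' b).+1 = r b] |
      [/\ r a = r' a, r b = r' b &
        (outer a b c r').+1 = outer a b c r \/
        (outer a b c r).+1 = outer a b c r' ]].
Proof.
move/gridP => [->|[i ri rN]]; first by constructor 1.
have [eqab|ab] := eqVneq a b; have [eqia|ia] := eqVneq i a.
- constructor 2; split=> //; last by rewrite -eqia.
  by apply: outer_eq => j ja _; rewrite rN // eqia.
- constructor 4; split; rewrite -?eqab ?rN 1?eq_sym //.
  have := @sum_update (fun j => (j != a) && (j != b))
    (fun j => gap (c j) (r j)) (fun j => gap (c j) (r' j)) i.
  rewrite -eqab ia /= -/(outer _ _ c r) -/(outer _ _ c r') => H.
  have {}H : outer a a c r + gap (c i) (r' i) = outer a a c r' + gap (c i) (r i).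
    by rewrite /outer; apply: H => j ji; rewrite rN.
  by move: H; rewrite /gap; lia.
- constructor 2; split; last by rewrite -eqia.
    by apply: outer_eq => j ja _; rewrite rN // eqia.
  by move=> _; rewrite rN // eqia eq_sym.
have [eqib|ib] := eqVneq i b.
  constructor 3; split; last by rewrite -eqib.
    by apply: outer_eq => j _ jb; rewrite rN // eqib.
  by rewrite rN // eqib.
constructor 4; split; rewrite ?rN 1?eq_sym //.
have := @sum_update (fun j => (j != a) && (j != b))
  (fun j => gap (c j) (r j)) (fun j => gap (c j) (r' j)) i.
rewrite ia ib /= -/(outer _ _ c r) -/(outer _ _ c r') => H.
have {}H : outer a b c r + gap (c i) (r' i) = outer a b c r' + gap (c i) (r i).
  by rewrite /outer; apply: H => j ji; rewrite rN.
by move: H; rewrite /gap; lia.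
Qed.

Definition approach_outer a b c r : {ffun 'I_d -> 'I_q} :=
  if [pick j | [&& j != a, j != b & 0 < gap (c j) (r j)]] is Some j
  then approach j c r else c.

Lemma approach_outer_legal a b c r : grid d q c (approach_outer a b c r).
Proof.
rewrite /approach_outer; case: pickP => [j _|_]; last exact: grid_refl.
exact: approach_legal.
Qed.

Lemma approach_outerP a b c r (c' := approach_outer a b c r) :
  0 < outer a b c r ->
  [/\ (outer a b c' r).+1 = outer a b c r, c' a = c a & c' b = c b].
Proof.
rewrite /c' /approach_outer => S0; case: pickP => [j /and3P[ja jb gj]|none].
  by split; rewrite ?outer_approach ?approach_neq // eq_sym.
move: S0; rewrite /outer big1 // => j /andP[ja jb].
by have := none j; rewrite ja jb /=; case: gap.
Qed.


Lemma outer_approach_in i a b c r (c' := approach i c r) : (i == a) || (i == b) ->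
  outer a b c' r = outer a b c r.
Proof.
move=> iab; apply: outer_eq => j ja jb; rewrite approach_neq //.
by apply/eqP => ji; move: iab; rewrite -ji (negbTE ja) (negbTE jb).
Qed.

Definition solo_reply l c r : {ffun 'I_d -> 'I_q} :=
  if 0 < outer l l c r then approach_outer l l c r else approach l c r.

Definition solo_potential l c r : nat :=
  solo_value q (outer l l c r) (c l) (r l).

Lemma solo_reply_legal l c r : grid d q c (solo_reply l c r).
Proof.
rewrite /solo_reply; case: ifP => _; first exact: approach_outer_legal.
exact: approach_legal.
Qed.

Lemma solo_potential_le l c r : solo_potential l c r <= d.+3 * q.
Proof.
have := outer_le l l c r; have := ltn_ord (c l).
by rewrite /solo_potential /solo_value /wall; do 2?case: ifP; lia.
Qed.

Lemma solo_round l c r r' (c' := solo_reply l c r') : grid d q r r' ->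
  c' = r' \/
  solo_potential l c' r' <= solo_potential l c r /\
  (r = r' \/ r l != r' l -> solo_potential l c' r' < solo_potential l c r).
Proof.
move=> rr'.
have moved : [\/ outer l l c r' = outer l l c r /\ r' l = r l :> nat,
    outer l l c r' = outer l l c r /\ stride (r l) (r' l) |
    r' l = r l :> nat /\ stride (outer l l c r) (outer l l c r')].
  case: (robber_move l l c rr') => [->|[E _ E2]|[E _ E2]|[E1 _ E2]].
  - by constructor 1.
  - by constructor 2.
  - by constructor 2.
  by constructor 3; split; [rewrite E1|case: E2; [right|left]].
have replied_outer : 0 < outer l l c r' ->
    (outer l l c' r').+1 = outer l l c r' /\ c' l = c l :> nat.
  move=> S'_gt0; rewrite /c' /solo_reply S'_gt0.
  by case: (approach_outerP S'_gt0) => -> ->.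
have replied_inner : outer l l c r' = 0 ->
    outer l l c' r' = 0 /\ c' l = toward (c l) (r' l) :> nat.
  by move=> S'0; rewrite /c' /solo_reply S'0 approachE outer_approach_in ?eqxx.
have [[S0 g0]|[le lt]] := solo_value_round (ltn_ord (c l)) (ltn_ord (r l))
  (ltn_ord (r' l)) moved replied_outer replied_inner.
  by left; apply: (gap_eq0 S0).
right; split=> // act; apply: lt.
case: (robber_move l l c rr') => [->|[E _ _]|[E _ _]|[E1 _ E2]] //.
by case: act => [->|] //; rewrite E1 eqxx.
Qed.

(** Taken with [c] the previous position of the robber: a cop that has caught the robber stays on
    it. This matters because catching a projection does not end the game. *)
Lemma solo_reply_adj l c r : grid d q c r -> solo_reply l c r = r.
Proof.
move=> cr; have [] := gaps_refl l l c => -[S0 g0] _.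
rewrite /solo_reply; case: (robber_move l l c cr) => [->|[E _ E2]|[E _ E2]|[E1 _ E2]].
- rewrite S0 /=; apply: (@gap_eq0 l l); rewrite ?outer_approach_in ?eqxx //
    approachE /toward ltnn //.
- rewrite E S0 /=; apply: (@gap_eq0 l l); rewrite ?outer_approach_in ?eqxx ?E //
    approachE; by move: E2; rewrite /toward /gap; do 2?case: ifP; lia.
- rewrite E S0 /=; apply: (@gap_eq0 l l); rewrite ?outer_approach_in ?eqxx ?E //
    approachE; by move: E2; rewrite /toward /gap; do 2?case: ifP; lia.
have S'_gt0 : 0 < outer l l c r by lia.
rewrite S'_gt0; have [S' c'l _] := approach_outerP S'_gt0.
have S'0 : outer l l (approach_outer l l c r) r = 0 by lia.
by apply: (gap_eq0 S'0); rewrite c'l E1 /gap subnn.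
Qed.

Definition parity a b c r : bool :=
  odd (outer a b c r + gap (c a) (r a) + gap (c b) (r b)).

(* Keeps the distance to the robber even at each turn of the robber: staying
   put answers a pass, and makes up for a wrong parity at the start. *)
Definition pair_reply a b c r : {ffun 'I_d -> 'I_q} :=
  if ~~ parity a b c r then c
  else if 0 < outer a b c r then approach_outer a b c r
  else if gap (c b) (r b) < gap (c a) (r a) then approach a c r
  else approach b c r.

Definition pair_potential a b c r : nat :=
  pair_value q (outer a b c r) (c a) (c b) (r a) (r b).

Lemma pair_reply_legal a b c r : grid d q c (pair_reply a b c r).
Proof.
rewrite /pair_reply; case: ifP => _; first exact: grid_refl.
case: ifP => _; first exact: approach_outer_legal.
by case: ifP => _; exact: approach_legal.
Qed.

Lemma pair_potential_le a b c r : pair_potential a b c r <= d.+3 * q.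
Proof.
have gap_le i : gap (c i) (r i) <= q.
  by have := ltn_ord (c i); have := ltn_ord (r i); rewrite /gap; lia.
have := outer_le a b c r; have := inner_value_le (gap_le a) (gap_le b)
  (wall_le (r a) (ltn_ord (c a))) (wall_le (r b) (ltn_ord (c b))).
by rewrite /pair_potential /pair_value; case: ifP; lia.
Qed.

Section PairReply.
Variables (a b : 'I_d) (c r : {ffun 'I_d -> 'I_q}).
Hypothesis ab : a != b.
Hypothesis odd_cr : parity a b c r.
Let c' := pair_reply a b c r.

Lemma pair_reply_outer : 0 < outer a b c r ->
  [/\ (outer a b c' r).+1 = outer a b c r, c' a = c a :> nat &
      c' b = c b :> nat].
Proof.
move=> S_gt0; rewrite /c' /pair_reply odd_cr /= S_gt0.
by case: (approach_outerP S_gt0) => -> -> ->.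
Qed.

Lemma pair_reply_inner : outer a b c r = 0 -> outer a b c' r = 0 /\
  if gap (c b) (r b) < gap (c a) (r a)
  then c' a = toward (c a) (r a) :> nat /\ c' b = c b :> nat
  else c' a = c a :> nat /\ c' b = toward (c b) (r b) :> nat.
Proof.
move=> S0; rewrite /c' /pair_reply odd_cr S0 /=; case: ifP => _;
  rewrite outer_approach_in ?eqxx ?orbT // approachE approach_neq //.
by rewrite eq_sym.
Qed.

(** The total distance is odd, hence positive, and the reply lowers it by exactly one. *)
Lemma pair_reply_parity : ~~ parity a b c' r.
Proof.
move: odd_cr; rewrite /parity; have [S0|] := posnP (outer a b c r).
  have [-> ] := pair_reply_inner S0; rewrite S0.
  by case: ifP => lt [-> ->]; move: lt; rewrite /gap /toward;
    do ![case: ifP => ?]; lia.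
by move=> /pair_reply_outer[<- -> ->]; rewrite /gap; lia.
Qed.

End PairReply.

Lemma pair_reply_even a b c r : a != b -> ~~ parity a b (pair_reply a b c r) r.
Proof.
move=> ab; have [odd_cr|even_cr] := boolP (parity a b c r).
  exact: pair_reply_parity.
by rewrite /pair_reply even_cr.
Qed.

Lemma pair_moved a b c r r' : a != b -> grid d q r r' -> r' != r ->
  [\/ [/\ outer a b c r' = outer a b c r, r' b = r b :> nat &
          stride (r a) (r' a)],
      [/\ outer a b c r' = outer a b c r, r' a = r a :> nat &
          stride (r b) (r' b)] |
      [/\ r' a = r a :> nat, r' b = r b :> nat &
          stride (outer a b c r) (outer a b c r')]].
Proof.
move=> ab rr'; case: (robber_move a b c rr') => [->|[-> E1 E2]|[-> -> E2]|[-> -> E2]] r'r.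
- by rewrite eqxx in r'r.
- by constructor 1; rewrite E1.
- by constructor 2.
by constructor 3; split=> //; case: E2; [right|left].
Qed.

Lemma pair_round a b c r r' (c' := pair_reply a b c r') : a != b ->
  ~~ parity a b c r -> grid d q r r' ->
  c' = r' \/
  pair_potential a b c' r' <= pair_potential a b c r /\
  ((r a != r' a) || (r b != r' b) ->
   pair_potential a b c' r' < pair_potential a b c r).
Proof.
move=> ab even_cr rr'; have [eqr|neqr] := eqVneq r' r.
  (* After a pass the parity is still even, so the cop stays put and the potential is unchanged. *)
  by right; rewrite /c' /pair_reply eqr even_cr !eqxx.
have moved := pair_moved c ab rr' neqr.
have odd_cr' : parity a b c r'.
  move: even_cr; rewrite /parity.
  case: moved => -[]; rewrite /stride => E1 E2 E3;
  by rewrite ?E1 ?E2 /gap; lia.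
have [[S0 [ga gb]]|[le lt]] := pair_value_round
  (ltn_ord (c a)) (ltn_ord (c b)) (ltn_ord (r a)) (ltn_ord (r b))
  (ltn_ord (r' a)) (ltn_ord (r' b)) even_cr moved
  (pair_reply_outer odd_cr') (pair_reply_inner ab odd_cr').
  by left; apply: (gap_eq0 S0).
right; split=> // act; apply: lt.
case: moved => -[] // E1 E2 _.
by move: act; rewrite -!val_eqE /= E1 E2 !eqxx.
Qed.

Lemma pair_reply_adj a b c r : a != b -> grid d q c r -> pair_reply a b c r = r.
Proof.
move=> ab cr; have even_cc : ~~ parity a b c c.
  by rewrite /parity !(gaps_refl a b c).
have [eqr|neqr] := eqVneq r c; first by rewrite /pair_reply eqr even_cc.
have moved := pair_moved c ab cr neqr.
have odd_cr : parity a b c r.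
  by rewrite /parity; move: moved; rewrite !(gaps_refl a b c) /stride /gap => -[] [];
    lia.
have [S0|S_gt0] := posnP (outer a b c r).
  have [S'0 E] := pair_reply_inner ab odd_cr S0.
  move: E moved; rewrite (gaps_refl a b c) S0 => E moved.
  have moved' : r b = c b :> nat /\ stride (c a) (r a) \/
                r a = c a :> nat /\ stride (c b) (r b).
    by case: moved => -[E1 E2 E3]; [left|right|case: E3].
  move: E; case: ifP => lt [E1 E2]; apply: (gap_eq0 S'0);
    rewrite ?E1 ?E2 ?gap_toward; move: lt; case: moved' => -[->];
    rewrite /stride /gap; lia.
have [S' ca cb] := pair_reply_outer odd_cr S_gt0.
have S'0 : outer a b (pair_reply a b c r) r = 0.
  by case: moved => -[]; rewrite (gaps_refl a b c) /stride; lia.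
apply: (gap_eq0 S'0); rewrite ?ca ?cb; case: moved => -[];
  by rewrite (gaps_refl a b c) /stride /gap; lia.
Qed.

End Approach.

(** * A team of cops on one grid *)

(* The solo cop makes progress when the robber passes, the cop of the pair
   [a j, b j] when the robber moves in one of these two coordinates, and no
   cop ever loses ground, so the sum of the potentials drops in every round. *)
Section Team.
Variables (d q : nat) (J : finType) (a b : J -> 'I_d) (l : 'I_d).
Hypothesis ab : forall j, a j != b j.
Hypothesis cover : forall i, i = l \/ exists j, i = a j \/ i = b j.
Local Notation T := {ffun 'I_d -> 'I_q}.

Definition team_reply (o : option J) : T -> T -> T :=
  if o is Some j then pair_reply (a j) (b j) else solo_reply l.

Definition team_potential (o : option J) : T -> T -> nat :=
  if o is Some j then pair_potential (a j) (b j) else solo_potential l.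

Definition pursuer (o : option J) (c0 : T) (h : seq T) : T :=
  foldl (team_reply o) c0 h.

Lemma team_reply_legal o (c r : T) : grid d q c (team_reply o c r).
Proof. by case: o => [j|]; [exact: pair_reply_legal|exact: solo_reply_legal]. Qed.

Lemma team_reply_adj o (c r : T) : grid d q c r -> team_reply o c r = r.
Proof. by case: o => [j|] /=; [exact: pair_reply_adj|exact: solo_reply_adj]. Qed.

Lemma team_potential_le o (c r : T) : team_potential o c r <= d.+3 * q.
Proof. by case: o => [j|]; [exact: pair_potential_le|exact: solo_potential_le]. Qed.

Lemma team_round (p : option J -> T) (r r' : T) : grid d q r r' ->
  (forall j, ~~ parity (a j) (b j) (p (Some j)) r) ->
  (exists o, team_reply o (p o) r' = r') \/
  \sum_o team_potential o (team_reply o (p o) r') r' <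
  \sum_o team_potential o (p o) r.
Proof.
move=> rr' even_p; pose p' o := team_reply o (p o) r'.
case: (boolP [exists o, p' o == r']) => [/existsP[z /eqP caught]|/existsPn free].
  by left; exists z.
right.
have le o : team_potential o (p' o) r' <= team_potential o (p o) r.
  have := free o; case: o => [j|] /=.
    by case: (pair_round (ab j) (even_p j) rr') => [->|[]//]; rewrite eqxx.
  by case: (solo_round l (p None) rr') => [->|[]//]; rewrite eqxx.
have [x lt] : exists o, team_potential o (p' o) r' < team_potential o (p o) r.
  have solo : r = r' \/ r l != r' l ->
      exists o, team_potential o (p' o) r' < team_potential o (p o) r.
    move=> act; exists None; have := free None; rewrite /p' /=.
    by case: (solo_round l (p None) rr') => [->|[_ /(_ act)]] //; rewrite eqxx.
  have [eqr|neqr] := eqVneq r r'; first by apply: solo; left.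
  have [i ri] : exists i, r i != r' i.
    apply/existsP; apply: contraNT neqr => /existsPn eqr.
    by apply/eqP/ffunP => i; apply/eqP/negPn/eqr.
  have [il|[j ij]] := cover i; first by apply: solo; right; rewrite -il.
  exists (Some j); have := free (Some j); rewrite /p' /=.
  case: (pair_round (ab j) (even_p j) rr') => [->|[_ lt] _]; first by rewrite eqxx.
  by apply: lt; case: ij => <-; rewrite ri ?orbT.
rewrite (bigD1 x) //= [ltnRHS](bigD1 x) //= -addSn.
by apply: leq_add => //; apply: leq_sum => o' _; exact: le.
Qed.

(** The sum of the potentials pays for every round before the first capture, and a capture persists.
    Hence some cop is on the robber at every [t] beyond the bound, not just once. *)
Lemma team_catches (c0 : T) (r : nat -> T) (t : nat) :
  robber_legal (grid d q) r -> #|J|.+1 * (d.+3 * q) < t ->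
  exists o, pursuer o c0 (mkseq r t.+1) = r t.
Proof.
move=> legal_r; pose p t o := pursuer o c0 (mkseq r t.+1).
have pS s o : p s.+1 o = team_reply o (p s o) (r s.+1).
  by rewrite /p /pursuer (mkseqS r s.+1) foldl_rcons.
suff inv s : (exists o, p s o = r s) \/
    \sum_o team_potential o (p s o) (r s) + s <= #|J|.+1 * (d.+3 * q).
  by move=> lt; case: (inv t) => // /(leq_trans (leq_addl _ _)); rewrite leqNgt lt.
elim: s => [|s [[z caught]|IH]].
- right; rewrite addn0 -card_option -sum_nat_const.
  by apply: leq_sum => o _; exact: team_potential_le.
- by left; exists z; rewrite pS caught; exact: team_reply_adj.
(* Even the position at [s = 0] results from a reply, namely to the robber's placement. *)
have even_p j : ~~ parity (a j) (b j) (p s (Some j)) (r s).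
  by case: s {IH} => [|s]; [rewrite /p|rewrite pS]; exact: pair_reply_even.
case: (team_round (legal_r s) even_p) => [[z caught]|lt].
  by left; exists z; rewrite pS.
right; apply: leq_trans IH; rewrite addnS -addSn leq_add2r.
by under eq_bigr do rewrite pS.
Qed.

End Team.

(** * Retractions of the grid onto boxes *)

Lemma grid_map (d q q' : nat) (f : 'I_d -> 'I_q -> 'I_q') :
  (forall i (x y : 'I_q), x.+1 = y -> f i x = f i y \/ (f i x).+1 = f i y) ->
  forall u v, grid d q u v -> grid d q' [ffun i => f i (u i)] [ffun i => f i (v i)].
Proof.
move=> lip u v /gridP[->|[i ui uv]]; first exact: grid_refl.
have N j : j != i -> f j (u j) = f j (v j) by move=> /uv ->.
have [fi|fi] := eqVneq (f i (u i)) (f i (v i)).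
  apply/gridP; left; apply/ffunP => j; rewrite !ffunE.
  by have [->|/N] := eqVneq j i.
apply/gridP; right; exists i => [|j ji]; rewrite !ffunE; last exact: N.
by case: ui => /(lip i)[E|E]; [|left| |right]; rewrite // E eqxx in fi.
Qed.

(* The last box of each axis is shifted to fit into the grid, so that boxes may
   overlap.  [box_proj] is a retraction of the grid onto the box [B]: a team of
   cops inside [B] chases the projection of the robber. *)
Section Boxes.
Variables (d n m N : nat).
Hypothesis m_gt0 : 0 < m.
Hypothesis le_mn : m <= n.
Hypothesis le_nNm : n <= N * m.
Implicit Type B : {ffun 'I_d -> 'I_N}.

Definition corner B (i : 'I_d) : nat := minn (B i * m) (n - m).

Lemma box_in_subproof B i (y : 'I_m) : corner B i + y < n.
Proof. by clear m_gt0 le_nNm; have := ltn_ord y; rewrite /corner; lia. Qed.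

Definition box_in B (u : {ffun 'I_d -> 'I_m}) : {ffun 'I_d -> 'I_n} :=
  [ffun i => Ordinal (box_in_subproof B i (u i))].

Lemma box_proj_subproof B i (x : 'I_n) : minn (x - corner B i) m.-1 < m.
Proof. by clear le_mn le_nNm; lia. Qed.

(** Truncated subtraction clamps at the lower face of the box, [minn] at the upper one. *)
Definition box_proj B (u : {ffun 'I_d -> 'I_n}) : {ffun 'I_d -> 'I_m} :=
  [ffun i => Ordinal (box_proj_subproof B i (u i))].

Lemma box_in_grid B u v :
  grid d m u v -> grid d n (box_in B u) (box_in B v).
Proof.
move=> uv; apply: (@grid_map _ _ _ (fun i y => Ordinal (box_in_subproof B i y)) _ _ _ uv).
by move=> i x y xy; right; rewrite /= -xy addnS.
Qed.

Lemma box_proj_grid B u v :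
  grid d n u v -> grid d m (box_proj B u) (box_proj B v).
Proof.
move=> uv; apply: (@grid_map _ _ _ (fun i y => Ordinal (box_proj_subproof B i y)) _ _ _ uv).
move=> i x y /= xy.
have [E|NE] := eqVneq (minn (x - corner B i) m.-1) (minn (y - corner B i) m.-1).
  by left; apply: val_inj.
by right; move: NE; rewrite -xy; lia.
Qed.

Lemma box_exists u : exists B, box_in B (box_proj B u) = u.
Proof.
have lt i : u i %/ m < N by rewrite ltn_divLR // (leq_trans _ le_nNm).
exists [ffun i => Ordinal (lt i)]; apply/ffunP => i; apply: val_inj.
rewrite !ffunE /corner /= !ffunE /=.
by have := divn_eq (u i) m; have := ltn_pmod (u i) m_gt0; have := ltn_ord (u i); lia.
Qed.

End Boxes.

(** * Upper bound on the capture time *)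

Lemma pair_coverage (d : nat) : 0 < d ->
  exists (a b : 'I_(d./2) -> 'I_d) (l : 'I_d),
    (forall j, a j != b j) /\
    forall i, i = l \/ exists j, i = a j \/ i = b j.
Proof.
move=> d_gt0.
have lta (j : 'I_(d./2)) : j.*2 < d by have := ltn_ord j; lia.
have ltb (j : 'I_(d./2)) : j.*2.+1 < d by have := ltn_ord j; lia.
have ltl : d.-1 < d by lia.
(* The pairs are [2j, 2j + 1], and the solo coordinate is the last one. For even [d] it also lies in
   a pair, but the solo cop is still the one that profits from passes. *)
exists (fun j => Ordinal (lta j)), (fun j => Ordinal (ltb j)), (Ordinal ltl).
split=> [j|i]; first by rewrite -val_eqE /=; lia.
have [lti|gei] := ltnP i./2 d./2; last first.
  by left; apply: val_inj; have := ltn_ord i => /=; lia.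
right; exists (Ordinal lti); have := odd_double_half i; case: odd => /= E.
  by right; apply: val_inj => /=; lia.
by left; apply: val_inj => /=; lia.
Qed.

Lemma capture_upper_bound (d n N k : nat) :
  0 < d -> 0 < n -> 0 < N -> (d./2).+1 * N ^ d <= k ->
  exists s : cop_strategy {ffun 'I_d -> 'I_n} k,
    winning_within (grid d n) s (((d./2).+1 * d.+3 + 2) * (n.-1 %/ N).+1).
Proof.
(* The side [m] of a box is [n / N] rounded up. *)
move=> d_gt0 n_gt0 N_gt0 le_k; set m := (_ %/ _).+1.
have m_gt0 : 0 < m by [].
have le_mn : m <= n by have := leq_div n.-1 N; rewrite /m; lia.
have le_nNm : n <= N * m.
  by have := divn_eq n.-1 N; have := ltn_pmod n.-1 N_gt0; rewrite /m; lia.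
have [a [b [l [ab cover]]]] := pair_coverage d_gt0.
pose role := (option 'I_(d./2) * {ffun 'I_d -> 'I_N})%type.
pose role0 : role := (None, [ffun=> Ordinal N_gt0]).
(* Surplus cops get the default role of [nth]. *)
pose role_of (i : 'I_k) := nth role0 (enum {: role}) i.
have role_onto x : exists i, role_of i = x.
  have lt : enum_rank x < k.
    apply: leq_trans le_k; apply: (leq_trans (ltn_ord _)).
    by rewrite card_prod card_option card_ffun !card_ord.
  by exists (Ordinal lt); rewrite /role_of /= nth_enum_rank.
pose c0 : {ffun 'I_d -> 'I_m} := [ffun=> Ordinal m_gt0].
pose s (h : seq {ffun 'I_d -> 'I_n}) (i : 'I_k) :=
  let: (o, B) := role_of i in
  box_in le_mn B (pursuer a b l o c0 (map (box_proj m_gt0 B) h)).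
exists s; split=> [h x i|r legal_r].
  rewrite /s; case: (role_of i) => o B; apply: box_in_grid.
  by rewrite map_rcons /pursuer foldl_rcons; exact: team_reply_legal.
(* At time [t] every team has a cop on its projection. The box is chosen only then, as one
   containing [r t]; its catcher stands on [r t] after the cops' move in round [t.+1]. *)
pose t := (#|'I_(d./2)|.+1 * (d.+3 * m)).+1.
exists t.+1; first by rewrite /t card_ord; lia.
have [B rt] := box_exists m_gt0 le_mn le_nNm (r t).
have [||o caught] := @team_catches _ _ _ a b l ab cover c0
  (fun u => box_proj m_gt0 B (r u)) t; [|by []|].
  by move=> u; apply: box_proj_grid.
have [i role_i] := role_onto (o, B); exists i; left.
rewrite /cops_at /s role_i -[RHS]rt -caught; congr (box_in _ _ (pursuer _ _ _ _ _ _)).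
by rewrite /mkseq -map_comp.
Qed.

(** * Lower bound on the capture time by counting *)

Lemma avoid_sets (T : finType) (k M : nat) (B : 'I_k -> {set T}) :
  (forall i, #|B i| <= M) -> k * M < #|T| -> exists v, forall i, v \notin B i.
Proof.
move=> leM lt.
have /subsetPn[v _ vB] : ~~ ([set: T] \subset \bigcup_i B i).
  apply: contraL lt => /subset_leq_card; rewrite cardsT -leqNgt => /leq_trans; apply.
  apply: (@leq_trans (\sum_(i < k) M)); last by rewrite sum_nat_const card_ord.
  apply: (@leq_trans (\sum_(i < k) #|B i|)); last by apply: leq_sum => i _.
  apply: (big_ind2 (fun (A : {set T}) x => #|A| <= x)) => [|A x A' x' le le'|//].
    by rewrite cards0.
  by apply: leq_trans (leq_card_setU _ _) _; exact: leq_add.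
by exists v => i; apply: contraNN vB => vi; apply/bigcupP; exists i.
Qed.

Section Bounds.
Variables d n k : nat.
Local Notation T := {ffun 'I_d -> 'I_n}.
Implicit Types c u v w : T.

(** Balls of the maximum norm contain those of the graph distance and are easy to count. *)
Definition ball (t : nat) (c : T) : {set T} :=
  [set v : T | [forall i, gap (c i) (v i) <= t]].

Lemma card_ball t c : #|ball t c| <= (t.*2.+1) ^ d.
Proof.
(* Shifting by [t - c i] sends the ball into a cube of side [2t + 1]; on the ball the subtraction
   does not truncate. *)
pose f (v : T) : {ffun 'I_d -> 'I_(t.*2.+1)} := [ffun i => inord (v i + t - c i)].
have f_inj : {in ball t c &, injective f}.
  move=> u v; rewrite !inE => /forallP ut /forallP vt /ffunP uv.
  apply/ffunP => i; apply: val_inj; have /(congr1 val) := uv i; rewrite !ffunE /=.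
  by have := ut i; have := vt i; rewrite /gap => ? ?; rewrite !inordK; lia.
rewrite -(card_in_imset f_inj); apply: leq_trans (max_card _) _.
by rewrite card_ffun !card_ord.
Qed.

Lemma grid_gap (u v : T) i : grid d n u v -> gap (u i) (v i) <= 1.
Proof.
move=> /gridP[->|[j uj uv]]; first by rewrite /gap; lia.
have [->|/uv ->] := eqVneq i j; last by rewrite /gap; lia.
by case: uj; rewrite /gap; lia.
Qed.

Lemma cop_reach (s : cop_strategy T k) (r : nat -> T) (i : 'I_k) t :
  cop_legal (grid d n) s -> cops_at s r t i \in ball t (s [::] i).
Proof.
move=> legal_s; rewrite inE; apply/forallP => x.
elim: t => [|t IH]; first by rewrite /cops_at /gap subnn.
have triangle x0 y z : gap x0 z <= gap x0 y + gap y z by rewrite /gap; lia.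
apply: leq_trans (triangle _ (s (mkseq r t) i x) _) _; rewrite -[leqRHS]addn1.
by apply: (leq_add IH); rewrite /cops_at mkseqS; exact/grid_gap/legal_s.
Qed.

(** Otherwise a robber could sit still at a vertex that no cop reaches within [t] rounds. *)
Lemma capture_lower_bound (s : cop_strategy T k) t :
  winning_within (grid d n) s t -> n ^ d <= k * (t.*2.+1) ^ d.
Proof.
move=> [legal_s win]; rewrite leqNgt; apply/negP => lt.
have [||v far] := @avoid_sets T k (t.*2.+1 ^ d) (fun i => ball t (s [::] i)).
- by move=> i; exact: card_ball.
- by rewrite card_ffun !card_ord.
have [|u le_ut [i caught]] := win (fun=> v); first by move=> ?; exact: grid_refl.
have {}caught : cops_at s (fun=> v) u i = v by case: caught.
have := cop_reach (fun=> v) i u legal_s; rewrite caught inE => /forallP near.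
by have := far i; rewrite inE => /negP; apply; apply/forallP => x;
  apply: leq_trans (near x) le_ut.
Qed.

(** * Escaping from at most [d / 2] cops *)

Definition diff (u v : T) : {set 'I_d} := [set i | u i != v i].

Lemma diff_grid u v : grid d n u v -> #|diff u v| <= 1.
Proof.
move/gridP => [->|[i _ uv]].
  by rewrite (_ : diff v v = finset.set0) ?cards0 //; apply/setP => j; rewrite !inE eqxx.
have /subset_leq_card : diff u v \subset finset.set1 i; last by rewrite cards1.
by apply/fintype.subsetP => j; rewrite !inE; apply: contraNT => /uv ->; rewrite eqxx.
Qed.

(** One neighbour for each coordinate: a step down, or up from 0. For [1 < n] the default of
    [insubd] is never taken. *)
Definition neighbour (v : T) (i : 'I_d) : T :=
  [ffun j => if j == i then insubd (v j) (if v j == 0 :> nat then 1 else (v j).-1)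
             else v j].

Lemma neighbour_neq v i j : j != i -> neighbour v i j = v j.
Proof. by rewrite ffunE => /negbTE->. Qed.

Lemma neighbour_stride v i : 1 < n -> stride (v i) (neighbour v i i).
Proof.
move=> n_gt1; rewrite ffunE eqxx val_insubd; have := ltn_ord (v i).
by rewrite /stride; case: eqVneq => v0 lt; rewrite ifT; lia.
Qed.

Lemma neighbour_grid v i : 1 < n -> grid d n v (neighbour v i).
Proof.
move=> n_gt1; apply/gridP; right; exists i => [|j ji]; last by rewrite neighbour_neq.
exact: neighbour_stride.
Qed.

(** If [c] agreed with [v] at [i], it would differ from [neighbour v i] there, hence only there, and
    so be equal to [v]. *)
Lemma blocked_sub c v i : 1 < n -> c != v -> grid d n c (neighbour v i) ->
  i \in diff c v.
Proof.
move=> n_gt1 cv cN; rewrite inE; apply: contraNneq cv => cvi.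
have vNi := neighbour_stride v i n_gt1.
case/gridP: cN => [E|[j _ cN]].
  by move: vNi; rewrite -cvi E /stride; lia.
have ij : i = j.
  apply/eqP; apply: contraT => ij; move: vNi; rewrite -(cN _ ij) cvi /stride; lia.
apply/eqP/ffunP => x; have [->//|xi] := eqVneq x i.
by rewrite cN -?ij // neighbour_neq.
Qed.

Lemma diff_blocked c v i : 1 < n -> grid d n c (neighbour v i) -> #|diff c v| <= 2.
Proof.
move=> n_gt1 cN.
have sub : diff c v \subset diff c (neighbour v i) :|: diff v (neighbour v i).
  apply/fintype.subsetP => j; rewrite !inE; apply: contraNT.
  by rewrite negb_or !negbK => /andP[/eqP-> /eqP->].
apply: leq_trans (subset_leq_card sub) _.
apply: leq_trans (leq_card_setU _ _) _.
by apply: (@leq_add _ _ 1 1); apply: diff_grid => //; exact: neighbour_grid.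
Qed.

Definition blocked (c v : T) : {set 'I_d} :=
  [set i | grid d n c (neighbour v i)].

Lemma card_blocked c v : 1 < n -> c != v ->
  #|blocked c v| <= if grid d n c v then 1 else 2.
Proof.
move=> n_gt1 cv.
have [->|[i]] := set_0Vmem (blocked c v); first by rewrite cards0.
have sub : blocked c v \subset diff c v.
  by apply/fintype.subsetP => j; rewrite inE; exact: blocked_sub.
rewrite inE => cN; apply: leq_trans (subset_leq_card sub) _.
by case: ifP => [/diff_grid//|_]; exact: diff_blocked cN.
Qed.

(* Each cop blocks at most 2 of the [d] chosen neighbours of [v], and a cop
   adjacent to [v] blocks at most 1; if no cop is adjacent, staying is safe. *)
Lemma safe_move (p : 'I_k -> T) v : 1 < n -> k.*2 <= d ->
  (forall i, p i != v) ->
  exists2 w, grid d n v w & forall i, ~~ grid d n (p i) w.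
Proof.
move=> n_gt1 kd pv.
have [/existsP[i0 near]|/existsPn far] := boolP [exists i, grid d n (p i) v];
  last by exists v => //; exact: grid_refl.
have /subsetPn[x _ xB] : ~~ ([set: 'I_d] \subset \bigcup_i blocked (p i) v).
  apply/negP => /subset_leq_card; rewrite cardsT card_ord => le_d.
  have : d < d; last by rewrite ltnn.
  apply: leq_trans _ kd.
  apply: leq_ltn_trans le_d _.
  apply: (@leq_ltn_trans (\sum_i #|blocked (p i) v|)).
    apply: (big_ind2 (fun (A : {set 'I_d}) x => #|A| <= x)) => [|A x A' x' le le'|//].
      by rewrite cards0.
    by apply: leq_trans (leq_card_setU _ _) _; exact: leq_add.
  rewrite (bigD1 i0) //= (leq_ltn_trans (leq_add (_ : _ <= 1) (_ : _ <= \sum_(i < k | i != i0) 2))) //.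
  - by have := card_blocked n_gt1 (pv i0); rewrite near.
  - apply: leq_sum => i _; apply: leq_trans (card_blocked n_gt1 (pv i)) _.
    by case: ifP.
  rewrite sum_nat_const; have := cardC1 i0; rewrite card_ord => ->.
  by have := ltn_ord i0; lia.
exists (neighbour v x); first exact: neighbour_grid.
move=> i; apply: contraNN xB => near_x; apply/bigcupP; exists i => //.
by rewrite inE.
Qed.

(** The robber ends each move neither on nor next to a cop, so the cops' next move cannot catch it,
    and [safe_move] restores the invariant. *)
Lemma escape (s : cop_strategy T k) : cop_legal (grid d n) s ->
  1 < n -> k.*2 <= d -> k * 3 ^ d < n ^ d -> ~ winning (grid d n) s.
Proof.
move=> legal_s n_gt1 kd lt [_ win].
(* A start outside the unit balls around all cops. *)
have [||v0 v0_safe] := @avoid_sets T k (3 ^ d) (fun i => ball 1 (s [::] i)).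
- by move=> i; exact: card_ball.
- by rewrite card_ffun !card_ord.
pose good h v := ((h == [::]) || grid d n (last v0 h) v) &&
                 [forall i, ~~ grid d n (s h i) v].
pose choice h := odflt v0 [pick v | good h v].
(* The choice depends on the whole history, so the robber's sequence comes from a recursion on
   histories. *)
pose hist := fix hist t := if t is t'.+1 then rcons (hist t') (choice (hist t')) else [::].
pose r t := choice (hist t).
have histS t : hist t.+1 = rcons (hist t) (r t) by [].
have histE t : mkseq r t = hist t by elim: t => // t IH; rewrite mkseqS IH.
have good_choice h : (exists v, good h v) -> good h (choice h).
  by move=> [v gv]; rewrite /choice; case: pickP => //= /(_ v); rewrite gv.
have good_r t : good (hist t) (r t).
  elim: t => [|t IH]; apply: good_choice.
    exists v0; rewrite /good eqxx; apply/forallP => i.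
    apply: contraNN (v0_safe i) => near; rewrite inE; apply/forallP => x.
    exact: grid_gap.
  have safe i : s (hist t.+1) i != r t.
    have [_ /forallP/(_ i)] := andP IH; apply: contraNneq => <-.
    exact: legal_s.
  have [w vw far] := safe_move n_gt1 kd safe.
  exists w; rewrite /good histS last_rcons vw orbT /=; exact/forallP.
have legal_r : robber_legal (grid d n) r.
  move=> t; have [/orP[/eqP/(congr1 size)|]] := andP (good_r t.+1).
    by rewrite histS size_rcons.
  by rewrite histS last_rcons.
have [t [i]] := win r legal_r.
rewrite /cops_at histE => -[]; last first.
  move=> E; have [_ /forallP/(_ i)] := andP (good_r t).
  by rewrite E grid_refl.
case: t => [|t] E.
  by have [_ /forallP/(_ i)] := andP (good_r 0); rewrite /= E grid_refl.
have [_ /forallP/(_ i)/negP] := andP (good_r t); apply.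
by rewrite -[r t]E histS; exact: legal_s.
Qed.

End Bounds.

(** * Bounds on [cop_number] and [capt] *)

Lemma cop_number_lower_bound (d n : nat) : 0 < d -> 3 * d.+1 <= n ->
  d./2 < cop_number (grid d n).
Proof.
move=> d_gt0 le_n; have n_gt0 : 0 < n by lia.
(* [least] is 0 on the empty set, so a winning team must be exhibited first: a single box,
   [N = 1]. *)
have [|[s win] _] := @leastP [set k | exists s : cop_strategy _ k, winning (grid d n) s]%classic.
  have [s [legal_s win]] := capture_upper_bound d_gt0 n_gt0 (ltn0Sn 0) (leqnn _).
  by exists ((d./2).+1 * 1 ^ d), s; split=> // r /win[t _]; exists t.
rewrite ltnNge; apply/negP => le_d; have [legal_s _] := win.
apply: (escape legal_s) win; first by lia.
  by apply: (@leq_trans (d./2).*2); [rewrite leq_double|lia].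
(* [d * 3 ^ d < (3 * d.+1) ^ d] because [d < d.+1 <= d.+1 ^ d]. *)
apply: (@leq_ltn_trans (d * 3 ^ d)); first by rewrite leq_mul2r (leq_trans le_d) ?orbT //; lia.
apply: (@leq_trans ((3 * d.+1) ^ d)); last by rewrite leq_exp2r.
rewrite expnMn mulnC ltn_pmul2l ?expn_gt0 //.
by apply: (leq_trans (ltnSn d)); rewrite -{1}(expn1 d.+1) leq_pexp2l.
Qed.

Lemma capt_spec (d n N k : nat) :
  0 < d -> 0 < n -> 0 < N -> (d./2).+1 * N ^ d <= k ->
  [/\ 0 < capt (grid d n) k,
      capt (grid d n) k <= ((d./2).+1 * d.+3 + 2) * (n.-1 %/ N).+1 &
      n ^ d <= k * (3 * capt (grid d n) k) ^ d].
Proof.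
move=> d_gt0 n_gt0 N_gt0 le_k.
have [s win] := capture_upper_bound d_gt0 n_gt0 N_gt0 le_k.
set t := (_ * _.+1) in win *.
have t_gt0 : 0 < t by rewrite muln_gt0 addn_gt0 orbT.
rewrite /capt; set A := (X in least X).
have [|[capt_gt0 [s' win']] capt_le] := @leastP A; first by exists t; split=> //; exists s.
split=> //; first by apply: capt_le; split=> //; exists s.
apply: leq_trans (capture_lower_bound win') _.
(* [2t + 1 <= 3t], as the capture time [t] is positive. *)
by rewrite leq_mul2l leq_exp2r //; apply/orP; right; lia.
Qed.

(** [N] is the integer part of the [d]-th root of [k / c]: the number of boxes per axis that [k]
    cops can man with teams of [c]. *)
Lemma root_exists (d c k : nat) : 0 < d -> 0 < c -> c <= k ->
  exists N, [/\ 0 < N, c * N ^ d <= k & k < c * N.+1 ^ d].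
Proof.
move=> d_gt0 c_gt0 le_ck.
have ex : exists N, c * N ^ d <= k by exists 1; rewrite exp1n muln1.
have ub N : c * N ^ d <= k -> N <= k.
  move=> le; have [->//|N_gt0] := posnP N.
  apply: leq_trans le; apply: (@leq_trans (N ^ d)); last exact: leq_pmull.
  by rewrite -{1}(expn1 N) leq_pexp2l.
case: (ex_maxnP ex ub) => N le maxN; exists N; split=> //.
  by apply: maxN; rewrite exp1n muln1.
by rewrite ltnNge; apply/negP => /maxN; rewrite ltnn.
Qed.

(** * The asymptotic statement *)

Unset Implicit Arguments.
Local Open Scope classical_set_scope.
Local Open Scope ring_scope.

Theorem theorem3p1 (R : realType) (d : nat) (hd : (0 < d)%N) (k : nat -> nat)
    (hc : forall n, (0 < n)%N -> (cop_number (grid d n) <= k n)%N)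
    (hO : (fun n => (k n)%:R : R^o) =O_\oo (fun n => n%:R ^+ d : R^o)) :
  (fun n => (capt (grid d n) (k n))%:R : R^o) =Theta_\oo
  (fun n => n%:R / (k n)%:R `^ d%:R^-1 : R^o).
Proof.
have [K K_gt0 leK] : exists2 K : R, 0 < K &
    \forall n \near \oo, `|(k n)%:R : R| <= K * `|n%:R ^+ d : R|.
  by have /eqO_exP := hO.
pose c := (d./2).+1; pose C := (c * d.+3 + 2)%N.
rewrite eqThetaE qualifE; apply/asboolP.
(* The 3 comes from [3 * capt] in [capt_spec]; with [x] the [d]-th root of [k n], the terms [2 * c]
   and [K + 1] bound [x / N] and [x / n]. *)
exists (3^-1, C%:R * (2 * c%:R + (K + 1))) => /=.
  rewrite invr_gt0 ltr0n /= mulr_gt0 ?ltr0n ?addn_gt0 ?orbT //.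
  by rewrite addr_gt0 ?mulr_gt0 ?ltr0n // addr_gt0.
near=> n.
have n_gt0 : (0 < n)%N by near: n; exists 1%N.
have le_ck : (c <= k n)%N.
  apply: leq_trans (hc n n_gt0); apply: cop_number_lower_bound => //.
  by near: n; exists (3 * d.+1)%N.
have k_le : (k n)%:R <= K * n%:R ^+ d :> R.
  have : `|(k n)%:R : R| <= K * `|n%:R ^+ d : R| by near: n.
  by rewrite ger0_norm ?ler0n // ger0_norm // exprn_ge0 // ler0n.
have [N [N_gt0 leN ltN]] := root_exists hd (ltn0Sn _) le_ck.
have [capt_gt0 capt_le le_capt] := capt_spec hd n_gt0 N_gt0 leN.
set t := capt _ _ in capt_gt0 capt_le le_capt *.
have k_gt0 : 0 < (k n)%:R :> R by rewrite ltr0n (leq_trans _ le_ck).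
set x := (k n)%:R `^ d%:R^-1.
have x_gt0 : 0 < x by rewrite powR_gt0.
have xd : x ^+ d = (k n)%:R.
  rewrite -powR_mulrn ?ltW // -powRrM mulVf ?pnatr_eq0 ?lt0n_neq0 //.
  by rewrite powRr1 // ltW.
have le_root (a b : R) : 0 <= a -> 0 <= b -> a ^+ d <= b ^+ d -> a <= b.
  by move=> a0 b0; rewrite ler_pXn2r.
have n_gt0R : 0 < n%:R :> R by rewrite ltr0n.
have N_gt0R : 0 < N%:R :> R by rewrite ltr0n.
rewrite [`|n%:R / x|]ger0_norm ?divr_ge0 ?ler0n ?(ltW x_gt0) // [`|t%:R|]ger0_norm ?ler0n //.
split.
  have : n%:R <= x * (3 * t%:R).
    apply: le_root; rewrite ?ler0n ?mulr_ge0 ?ler0n ?(ltW x_gt0) //.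
    by rewrite exprMn xd -!natrM -!natrX -natrM ler_nat.
  by rewrite ler_pdivrMl // ler_pdivrMr // mulrC.
have x_le_N : x <= 2 * c%:R * N%:R.
  apply: le_root; rewrite ?mulr_ge0 ?ler0n ?(ltW x_gt0) //.
  rewrite xd -!natrM -natrX ler_nat; apply: leq_trans (ltnW ltN) _.
  (* Uses [c <= c ^ d] and [N.+1 <= 2 * N]. *)
  rewrite mulnAC [X in (_ <= X ^ _)%N]mulnC expnMn; apply: leq_mul; first exact: (@leq_pexp2l c 1 d).
  by rewrite leq_exp2r //; lia.
have x_le_n : x <= (K + 1) * n%:R.
  apply: le_root; rewrite ?mulr_ge0 ?ler0n ?addr_ge0 ?(ltW x_gt0) ?(ltW K_gt0) //.
  rewrite xd exprMn; apply: le_trans k_le _; rewrite ler_pM2r ?exprn_gt0 //.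
  (* [K + 1] replaces [K] because a base of at least 1 is below its [d]-th power. *)
  apply: (@le_trans _ _ (K + 1)); first by rewrite lerDl.
  by rewrite ler_eXnr // lerDr ltW.
(* The rounding term 1 is absorbed by [x <= (K + 1) * n]; this is where [k = O(n^d)] enters. *)
apply: (@le_trans _ _ (C%:R * (n%:R / N%:R + 1))).
  apply: (@le_trans _ _ (C * (n.-1 %/ N).+1)%:R); first by rewrite ler_nat.
  rewrite natrM ler_pM2l ?ltr0n ?addn_gt0 ?orbT // -addn1 natrD lerD2r.
  rewrite ler_pdivlMr // -natrM ler_nat.
  by apply: leq_trans (leq_trunc_div _ _) (leq_pred _).
rewrite -mulrA ler_pM2l ?ltr0n ?addn_gt0 ?orbT // mulrDl.
apply: lerD.
  rewrite mulrA ler_pdivlMr // mulrAC ler_pdivrMr //.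
  by rewrite [leRHS]mulrAC mulrC ler_pM2r.
by rewrite mulrA ler_pdivlMr // mul1r.
Unshelve. all: by end_near. Qed.
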